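(* Let $A$ be a finite alphabet. Each of the following cubic functors is proper: $F_{\mathbb N}$ on the category of commutative monoids ($\mathbb N$-semimodules), $F_{\mathbb Q_+}$ on the category of $\mathbb Q_+$-semimodules, $F_{\mathbb R_+}$ on the category of convex cones ($\mathbb R_+$-semimodules), and $F_{[0,1]}$ on the category $\mathbf{PCA}$ of positively convex algebras. In fact, for any two $F$-coalgebras (for $F$ one of these functors) with free finitely generated carrier and any two elements of them having the same trace, a zig-zag relating those elements whose nodes are free and finitely generated can be found which is a span, i.e. has a single intermediate node, with outgoing arrows.
   Context: Monads on Sets: for a semiring $\mathbb S$, $T_{\mathbb S}X=\{\varphi\colon X\to\mathbb S\mid \operatorname{supp}\varphi \text{ finite}\}$, with $T_{\mathbb S}f(\varphi)(y)=\sum_{x\in f^{-1}(y)}\varphi(x)$, unit $x\mapsto(x\mapsto 1)$, multiplication $\mu(\Phi)(x)=\sum_{\varphi}\Phi(\varphi)\varphi(x)$; its Eilenberg–Moore category is the category of $\mathbb S$-semimodules, with free algebra on $n$ generators $\mathbb S^n$. $T_{[0,1]}$ is the monad of finitely supported subprobability distributions ($\varphi\colon X\to[0,1]$ with finite support and $\sum_x\varphi(x)\le 1$); its Eilenberg–Moore category is $\mathbf{PCA}$ (positively convex algebras: sets closed under subconvex combinations, morphisms preserving them), with free algebra on $n$ generators the simplex $\Delta^n=\{(\xi_1,\dots,\xi_n)\mid \xi_j\ge 0,\ \sum_j\xi_j\le 1\}$. For $\mathbb S\in\{\mathbb N,\mathbb Q_+,\mathbb R_+\}$ the cubic functor $F_{\mathbb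 S}$ on $\mathbb S$-semimodules is $F_{\mathbb S}X=\mathbb S\times X^A$, $F_{\mathbb S}f=\mathrm{id}_{\mathbb S}\times(f\circ -)$; $F_{[0,1]}$ on $\mathbf{PCA}$ is $F_{[0,1]}X=[0,1]\times X^A$, $F_{[0,1]}f=\mathrm{id}\times(f\circ -)$. For a coalgebra $c\colon X\to F X$ write $c(x)=(c_o(x),(c_a(x))_{a\in A})$, $c_\varepsilon=\mathrm{id}$, $c_{wa}=c_a\circ c_w$; the trace is $\mathrm{tr}_c(x)=(c_o(c_w(x)))_{w\in A^*}$, and two elements are behaviourally equivalent iff they have the same trace. For an endofunctor $F$ on the Eilenberg–Moore category of a finitary monad $T$ on Sets (unit $\eta$): a zig-zag relating $x\in(X,c)$ and $y\in(Y,d)$ is a diagram of $F$-coalgebra morphisms $(X,c)\xrightarrow{f_1}(Z_1,e_1)\xleftarrow{f_2}(Z_2,e_2)\xrightarrow{f_3}\cdots\xleftarrow{f_{2n}}(Y,d)$ together with $z_{2k}\in Z_{2k}$ ($z_0=x$, $z_{2n}=y$) with $f_{2k}(z_{2k})=f_{2k-1}(z_{2k-2})$ for $k=1,\dots,n$. $F$ is proper if for all $F$-coalgebras $(TB_1,c_1)$, $(TB_2,c_2)$ with $B_1,B_2$ finite and all $b_j\in B_j$ with $\eta_{B_1}(b_1)$ and $\eta_{B_2}(b_2)$ behaviourally equivalent, there is a zig-zag relating $\eta_{B_1}(b_1)$ with $\eta_{B_2}(b_2)$ all of whose nodes have free finitely generated carrier. *)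

(* Defs.v *)
From HB Require Import structures.
From mathcomp Require Import all_boot all_order all_algebra.
From mathcomp Require Import interval_inference boolp reals.

Set Implicit Arguments.
Unset Strict Implicit.
Unset Printing Implicit Defensive.

Import Order.TTheory GRing.Theory Num.Theory.
Local Open Scope ring_scope.

(* The Eilenberg-Moore category of a finitary monad T on sets, presented by    *)
(* its algebras, its homomorphisms and the free algebras T B over finite sets  *)
(* B with their units eta : B -> T B, characterized by [freeP].                *)
Record algCat := AlgCat {
  alg :> Type;
  carrier : alg -> Type;
  is_hom : forall X Y : alg, (carrier X -> carrier Y) -> Prop;
  is_hom_id : forall X, @is_hom X X id;
  is_hom_comp : forall X Y Z g f,
    @is_hom Y Z g -> @is_hom X Y f -> @is_hom X Z (g \o f);
  freealg : finType -> alg;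
  eta : forall B : finType, B -> carrier (freealg B);
  freeP : forall (B : finType) (Y : alg) (g : B -> carrier Y),
    exists2 f : carrier (freealg B) -> carrier Y,
      is_hom f /\ (forall b, f (eta b) = g b)
    & forall f', is_hom f' -> (forall b, f' (eta b) = g b) -> f' =1 f
}.

Record hom (C : algCat) (X Y : C) := Hom {
  hom_fun :> carrier X -> carrier Y;
  homP : is_hom hom_fun
}.

Definition idhom (C : algCat) (X : C) : hom X X := Hom (is_hom_id X).

Definition comphom (C : algCat) (X Y Z : C) (g : hom Y Z) (f : hom X Y) :
  hom X Z := Hom (is_hom_comp (homP g) (homP f)).

Definition free_fg (C : algCat) (X : C) : Prop :=
  exists (B : finType) (f : hom (freealg C B) X) (g : hom X (freealg C B)),
    cancel f g /\ cancel g f.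

Record endofunctor (C : algCat) := Endofunctor {
  fobj :> C -> C;
  fmap : forall X Y : C, hom X Y -> hom (fobj X) (fobj Y);
  fmap_id : forall X, fmap (idhom X) =1 id;
  fmap_comp : forall X Y Z (g : hom Y Z) (f : hom X Y),
    fmap (comphom g f) =1 fmap g \o fmap f
}.

Section Coalgebra.
Variables (C : algCat) (F : endofunctor C).

Record coalgebra := Coalg {
  node : C;
  cstr : hom node (F node)
}.

Definition elt (X : coalgebra) : Type := carrier (node X).

Record cohom (X Y : coalgebra) := Cohom {
  cohom_hom : hom (node X) (node Y);
  cohomP : forall x, cstr Y (cohom_hom x) = fmap F cohom_hom (cstr X x)
}.

Definition cohom_fun (X Y : coalgebra) (f : cohom X Y) : elt X -> elt Y :=
  cohom_hom f.
Local Coercion cohom_fun : cohom >-> Funclass.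

Definition behav_eq (X Y : coalgebra) (x : elt X) (y : elt Y) : Prop :=
  exists (Z : coalgebra) (f : cohom X Z) (g : cohom Y Z), f x = g y.

(* [zigzag P x y]: there is a zig-zag                                          *)
(*   X --f1--> Z1 <--f2-- Z2 --f3--> ... <--f2n-- Y                            *)
(* relating x and y all of whose nodes have carriers satisfying P.             *)
Inductive zigzag (P : C -> Prop) :
    forall X Y : coalgebra, elt X -> elt Y -> Prop :=
| Zigzag0 (X : coalgebra) (x : elt X) : P (node X) -> zigzag P x x
| ZigzagS (X Z1 Z2 Y : coalgebra) (f1 : cohom X Z1) (f2 : cohom Z2 Z1)
    (x : elt X) (z2 : elt Z2) (y : elt Y) :
    P (node X) -> P (node Z1) -> f2 z2 = f1 x ->
    zigzag P z2 y -> zigzag P x y.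

Definition coalg_span (P : C -> Prop) (X Y : coalgebra) (x : elt X) (y : elt Y) :
    Prop :=
  exists Z : coalgebra, P (node Z) /\
  exists (f : cohom Z X) (g : cohom Z Y) (z : elt Z), f z = x /\ g z = y.

Lemma id_cohomP (X : coalgebra) x :
  cstr X (idhom (node X) x) = fmap F (idhom (node X)) (cstr X x).
Proof. by rewrite fmap_id. Qed.

(* A span is the zig-zag X = X <-- Z --> Y = Y.                                *)
Lemma coalg_span_zigzag (P : C -> Prop) (X Y : coalgebra) (x : elt X) (y : elt Y) :
  P (node X) -> P (node Y) -> coalg_span P x y -> zigzag P x y.
Proof.
move=> PX PY [Z [PZ [f [g [z [fz gz]]]]]].
apply: (@ZigzagS P X X Z Y (Cohom (@id_cohomP X)) f x z y) => //.
apply: (@ZigzagS P Z Y Y Y g (Cohom (@id_cohomP Y)) z y y) => //.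
exact: Zigzag0.
Qed.

Definition proper_functor : Prop :=
  forall (B1 B2 : finType)
    (c1 : hom (freealg C B1) (F (freealg C B1)))
    (c2 : hom (freealg C B2) (F (freealg C B2)))
    (b1 : B1) (b2 : B2),
    @behav_eq (Coalg c1) (Coalg c2) (eta C b1) (eta C b2) ->
    @zigzag (@free_fg C) (Coalg c1) (Coalg c2) (eta C b1) (eta C b2).

Definition free_spans (A : finType) (O : Type)
    (tr : forall X : coalgebra, elt X -> seq A -> O) : Prop :=
  forall (X Y : coalgebra) (x : elt X) (y : elt Y),
    free_fg (node X) -> free_fg (node Y) -> tr X x =1 tr Y y ->
    coalg_span (@free_fg C) x y.

End Coalgebra.

Section Trace.
Variables (A : finType) (O X : Type) (c : X -> O * {ffun A -> X}).

(* c_w, letters being read from the left: run (rcons w a) = c_a \o run w.      *)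
Definition run (w : seq A) (x : X) : X := foldl (fun y a => (c y).2 a) x w.

Definition trace (x : X) (w : seq A) : O := (c (run w x)).1.

End Trace.

Lemma trace_morph (A : finType) (O X Y : Type) (c : X -> O * {ffun A -> X})
    (d : Y -> O * {ffun A -> Y}) (f : X -> Y) :
    (forall x, d (f x) = ((c x).1, [ffun a => f ((c x).2 a)])) ->
  forall x, trace d (f x) =1 trace c x.
Proof.
move=> fP x w; rewrite /trace /run; elim: w x => [|a w IH] x /=.
  by rewrite fP.
by rewrite fP ffunE IH.
Qed.

Section Semimodules.
Variable S : pzSemiRingType.

(* This is [semilinear f], which lives in Type.                                *)
Definition is_semilinear (X Y : lSemiModType S) (f : X -> Y) : Prop :=
  scalable f /\ {morph f : x y / x + y}.

Fact semilinear_id (X : lSemiModType S) : is_semilinear (@id X).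
Proof. by []. Qed.

Fact semilinear_comp (X Y Z : lSemiModType S) (g : Y -> Z) (f : X -> Y) :
  is_semilinear g -> is_semilinear f -> is_semilinear (g \o f).
Proof.
by move=> [gZ gD] [fZ fD]; split=> [a x|x y] /=; rewrite ?fZ ?gZ ?fD ?gD.
Qed.

Definition smod_free (B : finType) : lSemiModType S := {ffun B -> S^o}.

Definition smod_eta (B : finType) (b : B) : smod_free B :=
  [ffun b' => (b == b')%:R].

Fact smod_freeP (B : finType) (Y : lSemiModType S) (g : B -> Y) :
  exists2 f : smod_free B -> Y,
    is_semilinear f /\ (forall b, f (smod_eta b) = g b)
  & forall f', is_semilinear f' -> (forall b, f' (smod_eta b) = g b) ->
      f' =1 f.
Proof.
exists (fun u : {ffun B -> S^o} => \sum_b (u b : S) *: g b).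
  split; first split=> [a u|u v].
  - by rewrite scaler_sumr; apply: eq_bigr => b _; rewrite ffunE scalerA.
  - by rewrite -big_split; apply: eq_bigr => b _; rewrite ffunE scalerDl.
  - move=> b; rewrite (bigD1 b) //= big1 => [|i ib].
      by rewrite ffunE eqxx scale1r addr0.
    by rewrite ffunE eq_sym (negPf ib) scale0r.
move=> f [fZ fD] fg; move=> /= u; rewrite /smod_free in u *.
have f0 : f 0 = 0 by rewrite -[X in f X](scale0r 0) fZ scale0r.
have {1}-> : u = \sum_b (u b : S) *: smod_eta b.
  apply/ffunP=> b'; rewrite sum_ffunE (bigD1 b') //= big1 => [|i ib].
    by rewrite !ffunE eqxx /GRing.scale /= mulr1 addr0.
  by rewrite !ffunE (negPf ib) /GRing.scale /= mulr0.
rewrite (big_morph f fD f0); apply: eq_bigr => b _.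
by rewrite fZ fg.
Qed.

Definition SMod : algCat :=
  @AlgCat (lSemiModType S) (fun X => X) is_semilinear semilinear_id
    semilinear_comp smod_free smod_eta smod_freeP.

Variable A : finType.

Definition smod_cubic_obj (X : lSemiModType S) : lSemiModType S :=
  (S^o * {ffun A -> X})%type.

Definition smod_cubic_fun (X Y : lSemiModType S) (f : X -> Y)
    (u : smod_cubic_obj X) : smod_cubic_obj Y :=
  (u.1, [ffun a => f (u.2 a)]).

Fact smod_cubic_hom (X Y : SMod) (f : hom X Y) :
  is_semilinear (smod_cubic_fun f).
Proof.
have [fZ fD] := homP f; rewrite /smod_cubic_fun.
by split=> [k x|x y]; congr (_, _); apply/ffunP=> a;
  rewrite !ffunE ?fZ ?fD.
Qed.

Definition smod_cubic_map (X Y : SMod) (f : hom X Y) :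
    @hom SMod (smod_cubic_obj X) (smod_cubic_obj Y) :=
  @Hom SMod _ _ _ (smod_cubic_hom f).

Fact smod_cubic_id (X : SMod) : smod_cubic_map (idhom X) =1 id.
Proof. by case=> o t; congr (_, _); apply/ffunP=> a; rewrite ffunE. Qed.

Fact smod_cubic_comp (X Y Z : SMod) (g : hom Y Z) (f : hom X Y) :
  smod_cubic_map (comphom g f) =1 smod_cubic_map g \o smod_cubic_map f.
Proof. by case=> o t; congr (_, _); apply/ffunP=> a; rewrite !ffunE. Qed.

Definition smod_cubic : endofunctor SMod :=
  @Endofunctor SMod smod_cubic_obj smod_cubic_map smod_cubic_id
    smod_cubic_comp.

Definition smod_trace (X : coalgebra smod_cubic) : elt X -> seq A -> S :=
  @trace A S (elt X) (cstr X).

End Semimodules.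

(* The semiring of nonnegative elements of K, e.g. Q_+ = nonneg rat.           *)
Record nonneg (K : numDomainType) := Nonneg {
  nonneg_val : K;
  nonnegP : nonneg_val \is Num.nneg
}.

HB.instance Definition _ (K : numDomainType) := [isSub for @nonneg_val K].
HB.instance Definition _ (K : numDomainType) := [Choice of nonneg K by <:].
HB.instance Definition _ (K : numDomainType) :=
  [SubChoice_isSubComNzSemiRing of nonneg K by <:].

Section PositivelyConvexAlgebras.
Variable R : realType.

(* The simplex Delta^B, i.e. T_[0,1] B for B finite.                           *)
Record simplex (B : finType) := Simplex {
  weight :> {ffun B -> R};
  simplexP : [forall b, 0 <= weight b] && (\sum_b weight b <= 1)
}.

HB.instance Definition _ (B : finType) := [isSub for @weight B].

Lemma simplex_ge0 (B : finType) (p : simplex B) b : 0 <= p b.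
Proof. by have /andP[/forallP] := simplexP p. Qed.

Lemma simplex_le1 (B : finType) (p : simplex B) : \sum_b p b <= 1.
Proof. by have /andP[] := simplexP p. Qed.

Fact vertex_subproof (B : finType) (b : B) (f := [ffun b' => (b == b')%:R : R]) :
  [forall b', 0 <= f b'] && (\sum_b' f b' <= 1).
Proof.
apply/andP; split; first by apply/forallP=> b'; rewrite ffunE ler0n.
rewrite (bigD1 b) //= big1 => [|i ib]; first by rewrite ffunE eqxx addr0.
by rewrite ffunE eq_sym (negPf ib).
Qed.

Definition vertex (B : finType) (b : B) : simplex B := Simplex (vertex_subproof b).

Fact mix_subproof (I B : finType) (p : simplex I) (q : I -> simplex B)
    (f := [ffun b => \sum_i p i * q i b]) :
  [forall b, 0 <= f b] && (\sum_b f b <= 1).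
Proof.
apply/andP; split.
  apply/forallP=> b; rewrite ffunE sumr_ge0 // => i _.
  by rewrite mulr_ge0 ?simplex_ge0.
rewrite (eq_bigr (fun b => \sum_i p i * q i b)) => [|b _]; last by rewrite ffunE.
rewrite exchange_big /=; apply: le_trans (simplex_le1 p).
apply: ler_sum => i _; rewrite -mulr_sumr.
by rewrite ler_piMr ?simplex_ge0 ?simplex_le1.
Qed.

Definition mix (I B : finType) (p : simplex I) (q : I -> simplex B) : simplex B :=
  Simplex (mix_subproof p q).

(* Positively convex algebras: an operation x |-> \sum_i p_i x_i for every     *)
(* p in Delta^n, subject to the unit and the barycentre law.                   *)
Record pca := Pca {
  pca_sort :> Type;
  sconv : forall n : nat, simplex 'I_n -> ('I_n -> pca_sort) -> pca_sort;
  sconv_vertex : forall n (i : 'I_n) x, sconv (vertex i) x = x i;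
  sconv_mix : forall n m (p : simplex 'I_n) (q : 'I_n -> simplex 'I_m) x,
    sconv p (fun i => sconv (q i) x) = sconv (mix p q) x
}.

Definition is_pca_hom (X Y : pca) (f : X -> Y) : Prop :=
  forall n (p : simplex 'I_n) (x : 'I_n -> X),
    f (sconv p x) = sconv p (f \o x).

Fact pca_hom_id (X : pca) : is_pca_hom (@id X).
Proof. by []. Qed.

Fact pca_hom_comp (X Y Z : pca) (g : Y -> Z) (f : X -> Y) :
  is_pca_hom g -> is_pca_hom f -> is_pca_hom (g \o f).
Proof. by move=> gP fP n p x /=; rewrite fP gP. Qed.

Fact mix_vertex (B : finType) n (i : 'I_n) (x : 'I_n -> simplex B) :
  mix (vertex i) x = x i.
Proof.
apply/val_inj/ffunP=> b; rewrite ffunE (bigD1 i) //= big1 => [|j ji].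
  by rewrite ffunE eqxx mul1r addr0.
by rewrite ffunE eq_sym (negPf ji) mul0r.
Qed.

Fact mixA (B : finType) n m (p : simplex 'I_n) (q : 'I_n -> simplex 'I_m)
    (x : 'I_m -> simplex B) :
  mix p (fun i => mix (q i) x) = mix (mix p q) x.
Proof.
apply/val_inj/ffunP=> b; rewrite !ffunE.
under eq_bigr do rewrite ffunE mulr_sumr.
rewrite exchange_big; apply: eq_bigr => j _; rewrite ffunE mulr_suml.
by apply: eq_bigr => i _; rewrite mulrA.
Qed.

Definition pca_simplex (B : finType) : pca :=
  @Pca (simplex B) (fun n => @mix 'I_n B) (@mix_vertex B) (@mixA B).

Definition reindex_simplex (B : finType) (p : simplex B) : simplex 'I_#|B| :=
  mix p (fun b => vertex (enum_rank b)).

Lemma reindex_simplexE (B : finType) (p : simplex B) i :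
  reindex_simplex p i = p (enum_val i).
Proof.
rewrite ffunE (bigD1 (enum_val i)) //= big1 => [|b bi].
  by rewrite ffunE enum_valK eqxx mulr1 addr0.
rewrite ffunE; case: eqP => [E|_]; last by rewrite mulr0.
by rewrite -E enum_rankK eqxx in bi.
Qed.

Fact pca_freeP (B : finType) (Y : pca) (g : B -> Y) :
  exists2 f : pca_simplex B -> Y,
    is_pca_hom f /\ (forall b, f (vertex b) = g b)
  & forall f' : pca_simplex B -> Y,
      is_pca_hom f' -> (forall b, f' (vertex b) = g b) -> f' =1 f.
Proof.
exists (fun u => sconv (reindex_simplex u) (fun i => g (enum_val i))).
  split=> [n p x|b].
    rewrite /comp sconv_mix; congr sconv; apply/val_inj/ffunP=> i.
    rewrite reindex_simplexE !ffunE; apply: eq_bigr => j _.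
    by rewrite reindex_simplexE.
  rewrite (_ : reindex_simplex _ = vertex (enum_rank b)).
    by rewrite sconv_vertex enum_rankK.
  apply/val_inj/ffunP=> i; rewrite reindex_simplexE !ffunE.
  by rewrite -(inj_eq enum_rank_inj) enum_valK.
move=> f fP fg u.
have {1}-> : u = @sconv (pca_simplex B) _ (reindex_simplex u)
                   (fun i => vertex (enum_val i)).
  apply/val_inj/ffunP=> b; rewrite ffunE (bigD1 (enum_rank b)) //= big1.
    by rewrite reindex_simplexE ffunE enum_rankK eqxx mulr1 addr0.
  move=> i ib; rewrite [vertex _ _]ffunE; case: eqP => [E|_]; last by rewrite mulr0.
  by rewrite -E enum_valK eqxx in ib.
by rewrite fP; congr sconv; apply: funext => i; rewrite /= fg.
Qed.

Definition PCA : algCat :=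
  @AlgCat pca pca_sort is_pca_hom pca_hom_id pca_hom_comp
    pca_simplex vertex pca_freeP.

Fact i01_sum_ge0 n (p : simplex 'I_n) (x : 'I_n -> {i01 R}) :
  0 <= \sum_i p i * (x i)%:num.
Proof. by apply: sumr_ge0 => i _; rewrite mulr_ge0 ?simplex_ge0. Qed.

Fact i01_sum_le1 n (p : simplex 'I_n) (x : 'I_n -> {i01 R}) :
  \sum_i p i * (x i)%:num <= 1.
Proof.
apply: le_trans (simplex_le1 p); apply: ler_sum => i _.
by rewrite ler_piMr ?simplex_ge0.
Qed.

Definition i01_sconv n (p : simplex 'I_n) (x : 'I_n -> {i01 R}) : {i01 R} :=
  Itv01 (i01_sum_ge0 p x) (i01_sum_le1 p x).

Fact i01_sconv_vertex n (i : 'I_n) x : i01_sconv (vertex i) x = x i.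
Proof.
apply/val_inj; rewrite /= (bigD1 i) //= big1 => [|j ji].
  by rewrite ffunE eqxx mul1r addr0.
by rewrite ffunE eq_sym (negPf ji) mul0r.
Qed.

Fact i01_sconv_mix n m (p : simplex 'I_n) (q : 'I_n -> simplex 'I_m) x :
  i01_sconv p (fun i => i01_sconv (q i) x) = i01_sconv (mix p q) x.
Proof.
apply/val_inj => /=; under eq_bigr do rewrite mulr_sumr.
rewrite exchange_big; apply: eq_bigr => j _; rewrite ffunE mulr_suml.
by apply: eq_bigr => i _; rewrite mulrA.
Qed.

Definition pca_i01 : pca := Pca i01_sconv_vertex i01_sconv_mix.

Section CubicPCA.
Variable A : finType.

Definition pca_cubic_sort (X : pca) : Type := ({i01 R} * {ffun A -> X})%type.

Definition pca_cubic_sconv (X : pca) n (p : simplex 'I_n)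
    (x : 'I_n -> pca_cubic_sort X) : pca_cubic_sort X :=
  (@sconv pca_i01 n p (fun i => (x i).1),
   [ffun a => sconv p (fun i => (x i).2 a)]).

Fact pca_cubic_vertex (X : pca) n (i : 'I_n) x :
  @pca_cubic_sconv X n (vertex i) x = x i.
Proof.
rewrite /pca_cubic_sconv sconv_vertex [RHS]surjective_pairing.
by congr (_, _); apply/ffunP=> a; rewrite ffunE sconv_vertex.
Qed.

Fact pca_cubic_mix (X : pca) n m (p : simplex 'I_n) (q : 'I_n -> simplex 'I_m) x :
  pca_cubic_sconv p (fun i => @pca_cubic_sconv X m (q i) x) =
  pca_cubic_sconv (mix p q) x.
Proof.
congr (_, _); first exact: (@sconv_mix pca_i01).
apply/ffunP=> a; rewrite !ffunE -sconv_mix; congr sconv.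
by apply: funext => i; rewrite ffunE.
Qed.

Definition pca_cubic_obj (X : pca) : pca :=
  @Pca (pca_cubic_sort X) (@pca_cubic_sconv X) (@pca_cubic_vertex X)
    (@pca_cubic_mix X).

Definition pca_cubic_fun (X Y : pca) (f : X -> Y)
    (u : pca_cubic_obj X) : pca_cubic_obj Y :=
  (u.1, [ffun a => f (u.2 a)]).

Fact pca_cubic_hom (X Y : PCA) (f : hom X Y) : is_pca_hom (pca_cubic_fun f).
Proof.
move=> n p x; congr (_, _); apply/ffunP=> a; rewrite !ffunE.
rewrite (homP f n p); congr sconv; apply: funext => i.
by rewrite /= ffunE.
Qed.

Definition pca_cubic_map (X Y : PCA) (f : hom X Y) :
    @hom PCA (pca_cubic_obj X) (pca_cubic_obj Y) :=
  @Hom PCA _ _ _ (pca_cubic_hom f).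

Fact pca_cubic_id (X : PCA) : pca_cubic_map (idhom X) =1 id.
Proof. by case=> o t; congr (_, _); apply/ffunP=> a; rewrite ffunE. Qed.

Fact pca_cubic_comp (X Y Z : PCA) (g : hom Y Z) (f : hom X Y) :
  pca_cubic_map (comphom g f) =1 pca_cubic_map g \o pca_cubic_map f.
Proof. by case=> o t; congr (_, _); apply/ffunP=> a; rewrite !ffunE. Qed.

Definition pca_cubic : endofunctor PCA :=
  @Endofunctor PCA pca_cubic_obj pca_cubic_map pca_cubic_id pca_cubic_comp.

Definition pca_trace (X : coalgebra pca_cubic) : elt X -> seq A -> {i01 R} :=
  @trace A {i01 R} (elt X) (cstr X).

End CubicPCA.
End PositivelyConvexAlgebras.

(* The coalgebras of formal power series A^* -> S, resp. A^* -> [0,1], show    *)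
(* that behavioural equivalence is equality of traces.                         *)
Section FinalSMod.
Variables (S : pzSemiRingType) (A : finType).
Definition wseries : Type := seq A -> S.
HB.instance Definition _ := gen_eqMixin wseries.
HB.instance Definition _ := gen_choiceMixin wseries.

Fact wseries_addA : associative (fun (s t : wseries) w => s w + t w).
Proof. by move=> s t u; apply: funext => w; rewrite addrA. Qed.
Fact wseries_addC : commutative (fun (s t : wseries) w => s w + t w).
Proof. by move=> s t; apply: funext => w; rewrite addrC. Qed.
Fact wseries_add0 : left_id (fun=> 0) (fun (s t : wseries) w => s w + t w).
Proof. by move=> s; apply: funext => w; rewrite add0r. Qed.
HB.instance Definition _ :=
  @GRing.isNmodule.Build wseries (fun=> 0) _ wseries_addA wseries_addC wseries_add0.

Definition wseries_scale (a : S) (s : wseries) : wseries := fun w => a * s w.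
Fact wseries_scaleA a b s :
  wseries_scale a (wseries_scale b s) = wseries_scale (a * b) s.
Proof. by apply: funext => w; rewrite /wseries_scale mulrA. Qed.
Fact wseries_scale0 s : wseries_scale 0 s = 0.
Proof. by apply: funext => w; rewrite /wseries_scale mul0r. Qed.
Fact wseries_scale1 : left_id 1 wseries_scale.
Proof. by move=> s; apply: funext => w; rewrite /wseries_scale mul1r. Qed.
Fact wseries_scaleDr : right_distributive wseries_scale +%R.
Proof. by move=> a s t; apply: funext => w; rewrite /wseries_scale mulrDr. Qed.
Fact wseries_scaleDl s : {morph wseries_scale^~ s : a b / a + b}.
Proof. by move=> a b; apply: funext => w; rewrite /wseries_scale mulrDl. Qed.
HB.instance Definition _ := GRing.Nmodule_isLSemiModule.Build S wseries
  wseries_scaleA wseries_scale0 wseries_scale1 wseries_scaleDr wseries_scaleDl.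

Definition wseries_struct (s : wseries) : smod_cubic_obj A wseries :=
  (s [::], [ffun a => (fun w => s (a :: w)) : wseries]).

Fact wseries_structP : is_semilinear wseries_struct.
Proof. by split=> [a s|s t]; congr (_, _); apply/ffunP=> b; rewrite !ffunE. Qed.

Definition wseries_coalg : coalgebra (smod_cubic S A) :=
  @Coalg (SMod S) (smod_cubic S A) wseries (@Hom (SMod S) _ _ _ wseries_structP).

Fact smod_trace_hom (X : coalgebra (smod_cubic S A)) :
  @is_hom (SMod S) (node X) wseries (@smod_trace S A X).
Proof.
pose tr : node X -> seq A -> S := @smod_trace S A X.
suff H w : (forall a x, tr (a *: x) w = a * tr x w) /\
    (forall x y, tr (x + y) w = tr x w + tr y w).
  by split=> [a x|x y]; apply: funext => w; [apply (H w).1 | apply (H w).2].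
have [cZ cD] := homP (cstr X); rewrite /tr /smod_trace /trace /run.
elim: w => [|b w [IHZ IHD]] /=; split=> [a x|x y]; rewrite ?cZ ?cD //=.
  by rewrite ffunE; exact: IHZ.
by rewrite ffunE; exact: IHD.
Qed.

Fact smod_trace_cohom (X : coalgebra (smod_cubic S A)) x :
  cstr wseries_coalg (Hom (smod_trace_hom X) x) =
  fmap (smod_cubic S A) (Hom (smod_trace_hom X)) (cstr X x).
Proof. by congr (_, _); apply/ffunP=> a; rewrite !ffunE. Qed.

Lemma smod_behav_eqP (X Y : coalgebra (smod_cubic S A)) (x : elt X) (y : elt Y) :
  behav_eq x y <-> smod_trace x =1 smod_trace y.
Proof.
split=> [[Z [f [g fg]]] w|xy].
  rewrite -[LHS](trace_morph (cohomP f) x) -[RHS](trace_morph (cohomP g) y).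
  by move: fg; rewrite /cohom_fun => ->.
exists wseries_coalg, (Cohom (@smod_trace_cohom X)), (Cohom (@smod_trace_cohom Y)).
exact: funext xy.
Qed.
End FinalSMod.

Section FinalPCA.
Variables (R : realType) (A : finType).
Definition words : Type := seq A -> {i01 R}.
Definition words_sconv n (p : simplex R 'I_n) (s : 'I_n -> words) : words :=
  fun w => i01_sconv p (s^~ w).
Fact words_vertex n (i : 'I_n) s : words_sconv (vertex R i) s = s i.
Proof. by apply: funext => w; rewrite /words_sconv i01_sconv_vertex. Qed.
Fact words_mix n m (p : simplex R 'I_n) (q : 'I_n -> simplex R 'I_m) s :
  words_sconv p (fun i => words_sconv (q i) s) = words_sconv (mix p q) s.
Proof. by apply: funext => w; rewrite /words_sconv i01_sconv_mix. Qed.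
Definition pca_words : pca R := Pca words_vertex words_mix.
Definition words_struct (s : pca_words) : pca_cubic_obj A pca_words :=
  (s [::], [ffun a => (fun w => s (a :: w)) : words]).
Fact words_structP : is_pca_hom words_struct.
Proof.
move=> n p s; congr (_, _); apply/ffunP=> a; rewrite !ffunE; apply: funext=> w.
by congr i01_sconv; apply: funext => i; rewrite /= ffunE.
Qed.
Definition words_coalg : coalgebra (pca_cubic R A) :=
  @Coalg (PCA R) (pca_cubic R A) pca_words (@Hom (PCA R) _ _ _ words_structP).
Fact pca_trace_hom (X : coalgebra (pca_cubic R A)) :
  @is_hom (PCA R) (node X) pca_words (@pca_trace R A X).
Proof.
move=> n p x; apply: funext => w.
rewrite /pca_trace /trace /run.
elim: w x => [|b w IH] x /=; rewrite (homP (cstr X) n p x) //=.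
by rewrite ffunE; exact: IH.
Qed.
Fact pca_trace_cohom (X : coalgebra (pca_cubic R A)) x :
  cstr words_coalg (Hom (@pca_trace_hom X) x) =
  fmap (pca_cubic R A) (Hom (@pca_trace_hom X)) (cstr X x).
Proof. by congr (_, _); apply/ffunP=> a; rewrite !ffunE. Qed.

Lemma pca_behav_eqP (X Y : coalgebra (pca_cubic R A)) (x : elt X) (y : elt Y) :
  behav_eq x y <-> pca_trace x =1 pca_trace y.
Proof.
split=> [[Z [f [g fg]]] w|xy].
  rewrite -[LHS](trace_morph (cohomP f) x) -[RHS](trace_morph (cohomP g) y).
  by move: fg; rewrite /cohom_fun => ->.
exists words_coalg, (Cohom (@pca_trace_cohom X)), (Cohom (@pca_trace_cohom Y)).
exact: funext xy.
Qed.
End FinalPCA.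

(* Main.v *)
(* Let Z be the algebra of pairs (u, v) of elements with the same trace, i.e.  *)
(* the pullback of the two trace maps. It is closed under the transitions, so  *)
(* if Z is generated by finitely many pairs z_j, j in J, then the coalgebra    *)
(* structure lifts along the surjection T J -> Z, and T J is the node of the   *)
(* span. Over N, Z is closed under subtraction, so its minimal nonzero         *)
(* elements generate it and Dickson's lemma applies; over Q_+ and R_+, Z is    *)
(* the intersection of a linear subspace with an orthant, a finitely generated *)
(* cone; over [0,1], Z is a polytope, a slice of such a cone.                  *)

Require Import Defs.
From mathcomp Require Import all_boot all_order all_algebra reals.
From mathcomp Require Import interval_inference boolp.
(* Restores hom, shadowed by the hom of vector.v.                              *)
Import Defs.

Set Implicit Arguments.
Unset Strict Implicit.
Unset Printing Implicit Defensive.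

Import Order.TTheory GRing.Theory Num.Theory.
Local Open Scope ring_scope.

(** Equality of traces is compatible with the algebra operations and with the transitions. Once
    finitely many trace-equal pairs cover this relation in the sense of [fin_covered],
    [coalg_span_lift] turns the free algebra on them into the node of a span; spans are zig-zags, so
    properness follows ([free_spans_proper]). What remains is finite generation. After the reduction
    [fin_covered_free_fg], pairs are vectors indexed by [B1 + B2], subject to one linear equation
    per word. Over a semiring with cancellative addition the solution set is closed under those
    differences that exist, and this closure yields generators however many equations there are:
    through [dickson] over the naturals, through [cone_fin_gen] over nonnegative elements of an
    ordered field. Over [0,1], [pca_fin_covered_equalizer] homogenises the constraints and uses
    [cone_fin_gen] again. *)

(** * From finite covers to spans *)

Definition fin_covered (C : algCat) (X Y : C)
    (E : carrier X -> carrier Y -> Prop) : Prop :=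
  exists (J : finType) (p : hom (freealg C J) X) (q : hom (freealg C J) Y),
    (forall j, E (p (eta C j)) (q (eta C j))) /\
    (forall u v, E u v -> exists2 k, p k = u & q k = v).

Lemma hom_free_eq (C : algCat) (B : finType) (Y : C) (f g : hom (freealg C B) Y) :
  (forall b, f (eta C b) = g (eta C b)) -> f =1 g.
Proof.
move=> fg u; have [h _ hU] := freeP (fun b => f (eta C b)).
by rewrite (hU f (homP f)) ?(hU g (homP g)).
Qed.

Lemma free_hom (C : algCat) (B : finType) (Y : C) (g : B -> carrier Y) :
  exists f : hom (freealg C B) Y, forall b, f (eta C b) = g b.
Proof. by have [f [fP fg] _] := freeP g; exists (Hom fP). Qed.

Lemma free_fg_freealg (C : algCat) (B : finType) : free_fg (freealg C B).
Proof. by exists B, (idhom _), (idhom _). Qed.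

Lemma fin_covered_free_fg (C : algCat) (X Y : C)
    (E : carrier X -> carrier Y -> Prop) :
  (forall (B1 B2 : finType) (f : hom (freealg C B1) X) (g : hom (freealg C B2) Y),
    fin_covered (fun u v => E (f u) (g v))) ->
  free_fg X -> free_fg Y -> fin_covered E.
Proof.
move=> EF [B1 [f [f' [_ f'K]]]] [B2 [g [g' [_ g'K]]]].
have [J [p [q [Epq cov]]]] := EF B1 B2 f g.
exists J, (comphom f p), (comphom g q); split=> // u v Euv.
have [|k pk qk] := cov (f' u) (g' v); first by rewrite f'K g'K.
by exists k; rewrite /= ?pk ?qk.
Qed.

(* By freeness it suffices to lift the coalgebra structure on the generators.  *)
Lemma coalg_span_lift (C : algCat) (F : endofunctor C) (X Y : coalgebra F)
    (J : finType) (p : hom (freealg C J) (node X)) (q : hom (freealg C J) (node Y))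
    (k : carrier (freealg C J)) :
  (forall j, exists t : carrier (F (freealg C J)),
    fmap F p t = cstr X (p (eta C j)) /\ fmap F q t = cstr Y (q (eta C j))) ->
  @coalg_span C F (@free_fg C) X Y (p k) (q k).
Proof.
move=> /choice[t tP]; have [c ct] := free_hom t.
have pP : forall u, cstr X (p u) = fmap F p (c u).
  move=> u; apply: (@hom_free_eq C J _ (comphom (cstr X) p) (comphom (fmap F p) c)).
  by move=> b /=; rewrite ct (tP b).1.
have qP : forall u, cstr Y (q u) = fmap F q (c u).
  move=> u; apply: (@hom_free_eq C J _ (comphom (cstr Y) q) (comphom (fmap F q) c)).
  by move=> b /=; rewrite ct (tP b).2.
exists (Coalg c); split; first exact: free_fg_freealg.
by exists (@Cohom C F (Coalg c) X p pP), (@Cohom C F (Coalg c) Y q qP), k.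
Qed.

Lemma free_spans_proper (C : algCat) (F : endofunctor C) (A : finType) (O : Type)
    (tr : forall X : coalgebra F, elt X -> seq A -> O) :
  (forall (X Y : coalgebra F) (x : elt X) (y : elt Y),
    behav_eq x y -> tr X x =1 tr Y y) ->
  free_spans tr -> proper_functor F.
Proof.
move=> trP spans B1 B2 c1 c2 b1 b2 /trP tr12.
apply: coalg_span_zigzag; [exact: free_fg_freealg..|].
by apply: spans => //; exact: free_fg_freealg.
Qed.

(** Equal traces agree at [[::]], so outputs coincide, and at all [a :: w], so the [a]-successors
    are again trace-equal and the cover gives them a common preimage. This is the lift that
    [coalg_span_lift] asks for. *)
Lemma smod_fin_covered_span (S : pzSemiRingType) (A : finType)
    (X Y : coalgebra (smod_cubic S A)) (x : elt X) (y : elt Y) :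
  @fin_covered (SMod S) (node X) (node Y)
    (fun u v => @smod_trace S A X u =1 @smod_trace S A Y v) ->
  smod_trace x =1 smod_trace y -> coalg_span (@free_fg (SMod S)) x y.
Proof.
move=> [J [p [q [Epq cov]]]] /cov[k <- <-].
apply: coalg_span_lift => j.
have /choice[t tP] a : exists k, p k = (cstr X (p (eta (SMod S) j))).2 a /\
    q k = (cstr Y (q (eta (SMod S) j))).2 a.
  have [|l pl ql] := cov ((cstr X (p (eta (SMod S) j))).2 a)
      ((cstr Y (q (eta (SMod S) j))).2 a); last by exists l.
  by move=> w; exact: (Epq j (a :: w)).
exists ((cstr X (p (eta (SMod S) j))).1, [ffun a => t a]).
split; rewrite [RHS]surjective_pairing; congr (_, _).
- by apply/ffunP=> a; rewrite !ffunE (tP a).1.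
- exact: (Epq j [::]).
- by apply/ffunP=> a; rewrite !ffunE (tP a).2.
Qed.

Lemma pca_fin_covered_span (R : realType) (A : finType)
    (X Y : coalgebra (pca_cubic R A)) (x : elt X) (y : elt Y) :
  @fin_covered (PCA R) (node X) (node Y)
    (fun u v => @pca_trace R A X u =1 @pca_trace R A Y v) ->
  pca_trace x =1 pca_trace y -> coalg_span (@free_fg (PCA R)) x y.
Proof.
move=> [J [p [q [Epq cov]]]] /cov[k <- <-].
apply: coalg_span_lift => j.
have /choice[t tP] a : exists k, p k = (cstr X (p (eta (PCA R) j))).2 a /\
    q k = (cstr Y (q (eta (PCA R) j))).2 a.
  have [|l pl ql] := cov ((cstr X (p (eta (PCA R) j))).2 a)
      ((cstr Y (q (eta (PCA R) j))).2 a); last by exists l.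
  by move=> w; exact: (Epq j (a :: w)).
exists ((cstr X (p (eta (PCA R) j))).1, [ffun a => t a]).
split; rewrite [RHS]surjective_pairing; congr (_, _).
- by apply/ffunP=> a; rewrite !ffunE (tP a).1.
- exact: (Epq j [::]).
- by apply/ffunP=> a; rewrite !ffunE (tP a).2.
Qed.

(** * Finite generation of subtractive subsemimodules *)

(** Induction on the list [D] of coordinates to be compared. Let [s] work for the tail and let [N]
    bound its [i]-th coordinates: [s] handles every [z] with [N <= z i], and each of the finitely
    many slices [z i = k] with [k < N] is handled by induction. *)
Lemma dickson (I : finType) (P : {ffun I -> nat} -> Prop) :
  exists s : seq {ffun I -> nat}, (forall g, g \in s -> P g) /\
    (forall z, P z -> exists2 g, g \in s & forall i, (g i <= z i)%N).
Proof.
suff dicksonD (D : seq I) : forall P : {ffun I -> nat} -> Prop,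
    exists s : seq {ffun I -> nat}, (forall g, g \in s -> P g) /\
    (forall z, P z -> exists2 g, g \in s & {in D, forall i, g i <= z i}%N).
  have [s [sP cov]] := dicksonD (enum I) P; exists s; split=> // z /cov[g gs gz].
  by exists g => // i; apply: gz; rewrite mem_enum.
elim: D => [|i D IH] {}P.
  have [[z Pz]|nP] := pselect (exists z, P z).
    exists [:: z]; split=> [g|z' _]; first by rewrite inE => /eqP->.
    by exists z => //; rewrite mem_head.
  by exists [::]; split=> // z Pz; case: nP; exists z.
have [s [sP cov]] := IH P.
have /choice[t tP] k := IH (fun z => P z /\ z i = k).
pose N := (\max_(g <- s) g i)%N.
exists (s ++ flatten [seq t k | k <- iota 0 N]); split=> [g|z Pz].
  rewrite mem_cat => /orP[/sP//|/flatten_mapP[k _ gt]].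
  by have [] := (tP k).1 g gt.
have [Nz|zN] := leqP N (z i).
  have [g gs gz] := cov z Pz; exists g; first by rewrite mem_cat gs.
  move=> j; rewrite inE => /predU1P[->|/gz//]; apply: leq_trans Nz.
  by rewrite /N (big_rem g gs) leq_max leqnn.
have [g gt gz] := (tP (z i)).2 z (conj Pz erefl).
exists g; first by rewrite mem_cat; apply/orP; right; apply/flatten_mapP;
  exists (z i); rewrite ?mem_iota.
move=> j; rewrite inE => /predU1P[->|/gz//].
by have [_ ->] := (tP (z i)).1 g gt.
Qed.

(** The third closure condition says that a difference of members of [M] lies in [M] whenever it
    exists over [S]. *)
Definition subtractive_fin_gen (S : pzSemiRingType) : Prop :=
  forall (I : finType) (M : {ffun I -> S} -> Prop),
    M [ffun=> 0] ->
    (forall a z, M z -> M [ffun i => a * z i]) ->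
    (forall z z' : {ffun I -> S}, M z -> M [ffun i => z i + z' i] -> M z') ->
  exists (J : finType) (g : J -> {ffun I -> S}), (forall j, M (g j)) /\
    (forall z, M z -> exists k : J -> S, forall i, z i = \sum_j k j * g j i).

(** Every nonzero member dominates one of the finitely many nonzero members given by [dickson];
    subtracting it stays in [M] and lowers the coordinate sum, on which the induction runs. *)
Lemma nat_subtractive_fin_gen : subtractive_fin_gen nat.
Proof.
move=> I M M0 _ MB.
have [s [sP cov]] := dickson (fun z => M z /\ z <> [ffun=> 0]).
exists (seq_sub s), val; split=> [[g gs]|z]; first by have [] := sP g gs.
have [n] := ubnP (\sum_i z i)%N; elim: n z => // n IH z zn Mz.
have [->|/eqP z0] := eqVneq z [ffun=> 0].
  by exists (fun=> 0) => i; rewrite ffunE big1 // => j _; rewrite mul0r.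
have [g gs gz] := cov z (conj Mz z0).
have [Mg g0] := sP g gs.
pose z' := [ffun i => (z i - g i)%N].
have zE : z = [ffun i => g i + z' i].
  by apply/ffunP=> i; rewrite !ffunE natrDE subnKC.
have Mz' : M z' by apply: (MB g) => //; rewrite -zE.
have [|k kP] := IH z' _ Mz'.
  have sumE : (\sum_i z i = \sum_i g i + \sum_i z' i)%N.
    by rewrite -big_split; apply: eq_bigr => i _; rewrite {1}zE ffunE.
  rewrite -ltnS; apply: leq_trans zn; rewrite ltnS sumE -addn1 addnC leq_add2r.
  rewrite lt0n; apply/eqP => /eqP; rewrite sum_nat_eq0 => /forallP g00.
  by apply: g0; apply/ffunP=> i; rewrite ffunE; apply/eqP/g00.
exists (fun j => k j + (j == SeqSub gs)%:R) => i.
rewrite [in LHS]zE ffunE kP addrC.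
under [RHS]eq_bigr do rewrite mulrDl.
rewrite big_split; congr (_ + _).
rewrite (bigD1 (SeqSub gs)) //= eqxx mul1r big1 ?addr0 // => j /negPf->.
by rewrite mul0r.
Qed.

(* One vector per support is enough: subtracting from z a suitable multiple of *)
(* the chosen vector with the same support makes a coordinate of z vanish.     *)
Lemma cone_fin_gen (K : realFieldType) (I : finType) (M : {ffun I -> K} -> Prop) :
  M [ffun=> 0] -> (forall z, M z -> forall i, 0 <= z i) ->
  (forall a (z z' : {ffun I -> K}), 0 <= a -> M z -> M z' -> (forall i, a * z' i <= z i) ->
    M [ffun i => z i - a * z' i]) ->
  exists g : {set I} -> {ffun I -> K}, (forall D, M (g D)) /\
    (forall z, M z -> exists2 k : {set I} -> K, forall D, 0 <= k D
      & forall i, z i = \sum_D k D * g D i).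
Proof.
move=> M0 Mge0 MB.
pose supp (z : {ffun I -> K}) := [set i | z i != 0].
(* For sets [D] that are not supports of members of [M], the default choice is 0. *)
have /choice[g gP] D : exists g, M g /\ ((exists2 z, M z & supp z = D) -> supp g = D).
  have [[z Mz zD]|nD] := pselect (exists2 z, M z & supp z = D).
    by exists z.
  by exists [ffun=> 0]; split.
exists g; split=> [D|z]; first by have [] := gP D.
have [n] := ubnP #|supp z|; elim: n z => // n IH z zn Mz.
have [z0|[i1 i1z]] := set_0Vmem (supp z).
  exists (fun=> 0) => // i; rewrite big1 => [|D _]; last by rewrite mul0r.
  by apply/eqP; move/setP/(_ i): z0; rewrite !inE => /negbFE.
have [Mg /(_ (ex_intro2 _ _ z Mz erefl)) gz] := gP (supp z).
set D := supp z in i1z zn gz Mg *.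
have gD i : (g D i != 0) = (z i != 0).
  by move/setP/(_ i): gz; rewrite !inE.
have i1P : z i1 != 0 by rewrite inE in i1z.
(* The least ratio [a] is the largest multiple of [g D] that can be subtracted from [z] while
   staying nonnegative. *)
case: (@arg_minP _ _ _ i1 (fun i => z i != 0) (fun i => z i / g D i) i1P) => i0 i0P i0min.
pose a := z i0 / g D i0.
have gi_gt0 i : z i != 0 -> 0 < g D i.
  by move=> zi; rewrite lt_neqAle eq_sym gD zi Mge0.
have a0 : 0 <= a by rewrite divr_ge0 ?Mge0.
have az i : a * g D i <= z i.
  have [zi|zi] := eqVneq (z i) 0; last by rewrite -ler_pdivlMr ?gi_gt0 ?i0min.
  have /eqP-> : g D i == 0 by rewrite -[_ == _]negbK gD zi eqxx.
  by rewrite mulr0 zi.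
have [|k k0 kP] := IH _ _ (MB a z (g D) a0 Mz Mg az).
  (* No new coordinate enters the support, and [i0], where the minimum is attained, leaves it. *)
  rewrite -ltnS; apply: leq_trans zn; rewrite ltnS; apply: proper_card.
  apply/properP; split.
    apply/subsetP=> i; rewrite !inE ffunE; apply: contra_neq => zi.
    have /eqP-> : g D i == 0 by rewrite -[_ == _]negbK gD zi eqxx.
    by rewrite mulr0 zi subr0.
  exists i0; first by rewrite inE.
  by rewrite inE ffunE /a divfK ?subrr ?eqxx // gD.
exists (fun D' => k D' + (D' == D)%:R * a).
  by move=> D'; apply: addr_ge0 => //; apply: mulr_ge0.
move=> i; move: (kP i); rewrite ffunE => /eqP; rewrite subr_eq => /eqP->.
under [RHS]eq_bigr do rewrite mulrDl.
rewrite big_split; congr (_ + _).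
rewrite (bigD1 D) //= eqxx mul1r big1 ?addr0 // => j /negPf->.
by rewrite !mul0r.
Qed.

Lemma nonneg_subtractive_fin_gen (K : realFieldType) :
  subtractive_fin_gen (nonneg K).
Proof.
move=> I M M0 MZ MB.
pose nn (x : K) (x0 : 0 <= x) : nonneg K := @Nonneg K x x0.
pose lift (z : {ffun I -> nonneg K}) : {ffun I -> K} := [ffun i => val (z i)].
have lift_inj : injective lift.
  by move=> z z' /ffunP zz; apply/ffunP=> i; have := zz i; rewrite !ffunE => /val_inj.
have val_ge0 (x : nonneg K) : 0 <= val x by exact: (nonnegP x).
have [||a z z' a0 [y My <-] [y' My' <-] yy|g [gP cov]] :=
    @cone_fin_gen K I (fun z => exists2 y, M y & lift y = z).
- by exists [ffun=> 0] => //; apply/ffunP=> i; rewrite !ffunE.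
- by move=> _ [y My <-] i; rewrite ffunE.
- have y0 i : 0 <= lift y i - a * lift y' i by rewrite subr_ge0.
  exists [ffun i => nn _ (y0 i)]; last by apply/ffunP=> i; rewrite 2!ffunE [RHS]ffunE.
  (* The difference lies in [M] because adding the member [a * y'] to it gives back [y]. *)
  apply: (MB [ffun i => nn a a0 * y' i]); first exact: MZ.
  rewrite (_ : [ffun i => _] = y) //; apply/ffunP=> i; apply: val_inj.
  by rewrite !ffunE /= !(ffunE (fun i => val _)) addrC subrK.
have {gP}/choice[h hP] D : exists y, M y /\ lift y = g D.
  by have [y] := gP D; exists y.
exists {set I}, h; split=> [D|z Mz]; first by have [] := hP D.
have [|k k0 kP] := cov (lift z); first by exists z.
exists (fun D => nn _ (k0 D)) => i; apply: val_inj.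
rewrite raddf_sum /=; have := kP i; rewrite ffunE => ->.
by apply: eq_bigr => D _; rewrite -(hP D).2 ffunE.
Qed.

Lemma nonneg_addrI (K : numDomainType) : right_injective (@GRing.add (nonneg K)).
Proof. by move=> a b c /(congr1 val) /addrI /val_inj. Qed.

(** * Cubic functors on semimodules *)

(** A pair is coded as one vector [z] over [B1 + B2] with halves [fs z] and [sn z]. Cancellation in
    [S] makes the solutions of [s (fs z) =1 t (sn z)] subtractive, and the halves of their
    generators define [p] and [q]. *)
Lemma smod_fin_covered_equalizer (S : pzSemiRingType) (A B1 B2 : finType)
    (s : @hom (SMod S) (smod_free S B1) (wseries S A))
    (t : @hom (SMod S) (smod_free S B2) (wseries S A)) :
  subtractive_fin_gen S -> right_injective (@GRing.add S) ->
  @fin_covered (SMod S) (smod_free S B1) (smod_free S B2)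
    (fun u v => s u =1 t v).
Proof.
move=> gen addI; have [sZ sD] := homP s; have [tZ tD] := homP t.
have s0 : s (0 : smod_free S B1) = (0 : wseries S A).
  by rewrite -(scale0r (0 : smod_free S B1)) sZ scale0r.
have t0 : t (0 : smod_free S B2) = (0 : wseries S A).
  by rewrite -(scale0r (0 : smod_free S B2)) tZ scale0r.
pose fs (z : {ffun B1 + B2 -> S}) : smod_free S B1 := [ffun b => z (inl b)].
pose sn (z : {ffun B1 + B2 -> S}) : smod_free S B2 := [ffun b => z (inr b)].
have fsZ a (z : {ffun B1 + B2 -> S}) : fs [ffun i => a * z i] = a *: fs z.
  by apply/ffunP=> b; rewrite !ffunE.
have snZ a (z : {ffun B1 + B2 -> S}) : sn [ffun i => a * z i] = a *: sn z.
  by apply/ffunP=> b; rewrite !ffunE.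
have fsD (z z' : {ffun B1 + B2 -> S}) : fs [ffun i => z i + z' i] = fs z + fs z'.
  by apply/ffunP=> b; rewrite !ffunE.
have snD (z z' : {ffun B1 + B2 -> S}) : sn [ffun i => z i + z' i] = sn z + sn z'.
  by apply/ffunP=> b; rewrite !ffunE.
have [|a z stz w|z z' stz stz' w|J [g [gP cov]]] :=
    gen _ (fun z : {ffun B1 + B2 -> S} => s (fs z) =1 t (sn z)).
- have -> : fs [ffun=> 0] = 0 by apply/ffunP=> b; rewrite !ffunE.
  have -> : sn [ffun=> 0] = 0 by apply/ffunP=> b; rewrite !ffunE.
  by rewrite s0 t0.
- by rewrite fsZ snZ sZ tZ; congr (_ * _).
- have := stz' w; rewrite fsD snD sD tD => E; apply: (addI (s (fs z) w)).
  exact: etrans E (congr1 (fun c => c + t (sn z') w) (esym (stz w))).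
have [p pg] := @free_hom (SMod S) J (smod_free S B1) (fun j => fs (g j)).
have [q qg] := @free_hom (SMod S) J (smod_free S B2) (fun j => sn (g j)).
exists J, p, q; split=> [j|u v uv]; first by rewrite pg qg.
pose z : {ffun B1 + B2 -> S} :=
  [ffun i => match i with inl b => u b | inr b => v b end].
have fz : fs z = u by apply/ffunP=> b; rewrite !ffunE.
have sz : sn z = v by apply/ffunP=> b; rewrite !ffunE.
have [|k kP] := cov z; first by rewrite fz sz.
pose kf : smod_free S J := [ffun j => k j].
have homE (B : finType) (f : @hom (SMod S) (smod_free S J) (smod_free S B)) b :
    f kf b = \sum_j k j * f (smod_eta S j) b.
  have [fZ fD] := homP f.
  have f0 : f 0 = 0 by rewrite -[X in f X](scale0r 0) fZ scale0r.
  have -> : kf = \sum_j k j *: smod_eta S j.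
    apply/ffunP=> j; rewrite sum_ffunE (bigD1 j) //= big1 => [|i ij].
      by rewrite !ffunE eqxx /GRing.scale /= mulr1 addr0.
    by rewrite !ffunE (negPf ij) /GRing.scale /= mulr0.
  rewrite (big_morph f fD f0) sum_ffunE.
  by apply: eq_bigr => j _; rewrite fZ ffunE.
exists kf; apply/ffunP=> b; rewrite homE.
  by under eq_bigr do rewrite pg ffunE; have := kP (inl b); rewrite ffunE.
by under eq_bigr do rewrite qg ffunE; have := kP (inr b); rewrite ffunE.
Qed.

Lemma smod_cubic_free_spans (S : pzSemiRingType) (A : finType) :
  subtractive_fin_gen S -> right_injective (@GRing.add S) ->
  free_spans (@smod_trace S A).
Proof.
move=> gen addI X Y x y freeX freeY; apply: smod_fin_covered_span.
apply: fin_covered_free_fg freeX freeY => B1 B2 f g.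
exact: (smod_fin_covered_equalizer
  (@comphom (SMod S) _ _ (wseries S A) (Hom (smod_trace_hom X)) f)
  (@comphom (SMod S) _ _ (wseries S A) (Hom (smod_trace_hom Y)) g)).
Qed.

Lemma smod_cubic_proper (S : pzSemiRingType) (A : finType) :
  subtractive_fin_gen S -> right_injective (@GRing.add S) ->
  proper_functor (smod_cubic S A) /\ free_spans (@smod_trace S A).
Proof.
move=> gen addI; have spans := @smod_cubic_free_spans S A gen addI.
by split=> //; apply: free_spans_proper spans => X Y x y /smod_behav_eqP.
Qed.

(** * The cubic functor on positively convex algebras *)

Lemma pca_hom_sconv (R : realType) (B : finType) (Y : PCA R)
    (f : @hom (PCA R) (pca_simplex R B) Y) (u : simplex R B) :
  f u = sconv (reindex_simplex u) (fun i => f (vertex R (enum_val i))).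
Proof.
rewrite -(homP f _ (reindex_simplex u) (fun i => vertex R (enum_val i))).
congr (f _); apply/val_inj/ffunP=> b; rewrite ffunE (bigD1 (enum_rank b)) //=.
rewrite big1 => [|i ib].
  by rewrite reindex_simplexE ffunE enum_rankK eqxx mulr1 addr0.
rewrite [vertex _ _ _]ffunE; case: eqP => [E|_]; last by rewrite mulr0.
by rewrite -E enum_valK eqxx in ib.
Qed.

Lemma pca_hom_simplexE (R : realType) (B B' : finType)
    (f : @hom (PCA R) (pca_simplex R B) (pca_simplex R B')) (u : simplex R B) b' :
  (f u : simplex R B') b' = \sum_b u b * (f (vertex R b) : simplex R B') b'.
Proof.
rewrite pca_hom_sconv ffunE [RHS](reindex _ (onW_bij _ (@enum_val_bij B))).
by apply: eq_bigr => i _; rewrite reindex_simplexE.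
Qed.

(** Turns [s u =1 t v] into linear equations in the weights of [u] and [v], one per word. *)
Lemma pca_hom_wordsE (R : realType) (A B : finType)
    (f : @hom (PCA R) (pca_simplex R B) (pca_words R A)) (u : simplex R B) w :
  ((f u : words R A) w)%:num =
  \sum_b u b * ((f (vertex R b) : words R A) w)%:num.
Proof.
rewrite pca_hom_sconv [RHS](reindex _ (onW_bij _ (@enum_val_bij B))).
by apply: eq_bigr => i _; rewrite reindex_simplexE.
Qed.

(** When [T = 0] the bound forces [f] to vanish, and division by 0 returns 0, so both equations
    still hold. *)
Lemma simplex_div (R : realType) (B : finType) (f : B -> R) (T : R) :
  (forall b, 0 <= f b) -> \sum_b f b <= T ->
  exists v : simplex R B, forall b, v b = f b / T /\ f b = T * v b.
Proof.
move=> f0 fT; have sum0 : 0 <= \sum_b f b by exact: sumr_ge0.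
have T0 := le_trans sum0 fT.
have vP : [forall b, 0 <= [ffun b => f b / T] b] &&
    (\sum_b [ffun b => f b / T] b <= 1).
  apply/andP; split; first by apply/forallP=> b; rewrite ffunE divr_ge0.
  under eq_bigr do rewrite ffunE.
  rewrite -mulr_suml; have [->|Tn0] := eqVneq T 0; first by rewrite invr0 mulr0.
  by rewrite ler_pdivrMr ?mul1r // lt_neqAle eq_sym Tn0.
exists (Simplex vP) => b; rewrite /= ffunE; split=> //.
have [TE|Tn0] := eqVneq T 0; last by rewrite mulrC divfK.
rewrite TE mul0r; apply/le_anti; rewrite f0 andbT -{1}TE.
apply: le_trans fT; rewrite (bigD1 b) //= lerDl.
exact: sumr_ge0.
Qed.

(* The polytope of pairs (u, v) with s u = t v is the slice T = 1 of the cone  *)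
(* obtained by adding one slack variable for each of the constraints           *)
(* sum u <= T and sum v <= T.                                                  *)
Lemma pca_fin_covered_equalizer (R : realType) (A B1 B2 : finType)
    (s : @hom (PCA R) (pca_simplex R B1) (pca_words R A))
    (t : @hom (PCA R) (pca_simplex R B2) (pca_words R A)) :
  @fin_covered (PCA R) (pca_simplex R B1) (pca_simplex R B2)
    (fun u v => (s u : words R A) =1 (t v : words R A)).
Proof.
pose sv b w : R := ((s (vertex R b) : words R A) w)%:num.
pose tv b w : R := ((t (vertex R b) : words R A) w)%:num.
(* The two booleans index the slack variables, [true] for [u] and [false] for [v]. *)
pose I := (bool + (B1 + B2))%type.
pose T1 (z : {ffun I -> R}) := z (inl true) + \sum_b z (inr (inl b)).
pose T2 (z : {ffun I -> R}) := z (inl false) + \sum_b z (inr (inr b)).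
pose M (z : {ffun I -> R}) := [/\ forall i, 0 <= z i, T1 z = T2 z &
  forall w, \sum_b z (inr (inl b)) * sv b w = \sum_b z (inr (inr b)) * tv b w].
have [|z []//|a z z' a0 [z0 zT zw] [z'0 z'T z'w] zz'|g [gM cov]] :=
    @cone_fin_gen R I M.
- split=> [i||w]; first by rewrite ffunE.
    by rewrite /T1 /T2 !ffunE !big1 // => i _; rewrite ffunE.
  by rewrite !big1 // => i _; rewrite ffunE mul0r.
- split=> [i||w]; first by rewrite ffunE subr_ge0.
    have T1B : T1 [ffun i => z i - a * z' i] = T1 z - a * T1 z'.
      rewrite /T1 ffunE; under eq_bigr do rewrite ffunE.
      by rewrite sumrB -mulr_sumr mulrDr opprD addrACA.
    have T2B : T2 [ffun i => z i - a * z' i] = T2 z - a * T2 z'.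
      rewrite /T2 ffunE; under eq_bigr do rewrite ffunE.
      by rewrite sumrB -mulr_sumr mulrDr opprD addrACA.
    by rewrite T1B T2B zT z'T.
  under eq_bigr do rewrite ffunE mulrBl -mulrA.
  under [RHS]eq_bigr do rewrite ffunE mulrBl -mulrA.
  by rewrite !sumrB -!mulr_sumr zw z'w.
(* Each generator of the cone is rescaled to the slice [T1 = 1]; one with [T1 = 0] becomes the zero
   pair. *)
have /choice[u uP] D : exists u : simplex R B1, forall b,
    u b = g D (inr (inl b)) / T1 (g D) /\ g D (inr (inl b)) = T1 (g D) * u b.
  have [g0 _ _] := gM D; apply: (simplex_div (f := fun b => g D (inr (inl b)))) => //.
  by rewrite lerDr.
have /choice[v vP] D : exists v : simplex R B2, forall b,
    v b = g D (inr (inr b)) / T1 (g D) /\ g D (inr (inr b)) = T1 (g D) * v b.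
  have [g0 gT _] := gM D; apply: (simplex_div (f := fun b => g D (inr (inr b)))) => //.
  by rewrite gT lerDr.
have [p pg] := @free_hom (PCA R) {set I} (pca_simplex R B1) u.
have [q qg] := @free_hom (PCA R) {set I} (pca_simplex R B2) v.
exists {set I}, p, q; split=> [D w|x y xy].
  rewrite pg qg; apply: val_inj; rewrite /= !pca_hom_wordsE -/(sv _ _).
  under eq_bigr do rewrite (uP D _).1 mulrAC.
  under [RHS]eq_bigr do rewrite (vP D _).1 mulrAC.
  by have [_ _ gw] := gM D; rewrite -!mulr_suml gw.
pose z : {ffun I -> R} := [ffun i => match i with
  | inl true => 1 - \sum_b (x : simplex R B1) b
  | inl false => 1 - \sum_b (y : simplex R B2) b
  | inr (inl b) => (x : simplex R B1) b
  | inr (inr b) => (y : simplex R B2) b end].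
have z1 : T1 z = 1.
  by rewrite /T1 ffunE; under [X in _ + X]eq_bigr do rewrite ffunE; rewrite subrK.
have [|k k0 kP] := cov z.
  split=> [i||w].
  - by rewrite ffunE; case: i => [[]|[]] *; rewrite ?subr_ge0 ?simplex_le1 ?simplex_ge0.
  - by rewrite z1 /T2 ffunE; under [X in _ + X]eq_bigr do rewrite ffunE; rewrite subrK.
  under eq_bigr do rewrite ffunE; under [RHS]eq_bigr do rewrite ffunE.
  by rewrite -!pca_hom_wordsE xy.
(* Rescaling the generators multiplies the coefficients by [T1 (g D)]. By linearity of [T1] they
   then add up to [T1 z = 1]. *)
have kS : [forall D, 0 <= [ffun D => k D * T1 (g D)] D] &&
    (\sum_D [ffun D => k D * T1 (g D)] D <= 1).
  apply/andP; split.
    apply/forallP=> D; rewrite ffunE mulr_ge0 //; have [g0 _ _] := gM D.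
    by rewrite addr_ge0 ?sumr_ge0.
  under eq_bigr do rewrite ffunE mulrDr mulr_sumr.
  rewrite big_split exchange_big -kP -z1.
  by under eq_bigr do rewrite -kP.
exists (Simplex kS); apply/val_inj/ffunP=> b; rewrite /= pca_hom_simplexE.
  under eq_bigr do rewrite pg /= ffunE -mulrA -(uP _ _).2.
  by rewrite -kP ffunE.
under eq_bigr do rewrite qg /= ffunE -mulrA -(vP _ _).2.
by rewrite -kP ffunE.
Qed.

Lemma pca_cubic_free_spans (R : realType) (A : finType) :
  free_spans (@pca_trace R A).
Proof.
move=> X Y x y freeX freeY; apply: pca_fin_covered_span.
apply: fin_covered_free_fg freeX freeY => B1 B2 f g.
exact: (pca_fin_covered_equalizer
  (@comphom (PCA R) _ _ (pca_words R A) (Hom (@pca_trace_hom R A X)) f)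
  (@comphom (PCA R) _ _ (pca_words R A) (Hom (@pca_trace_hom R A Y)) g)).
Qed.

Theorem theorem6 (R : realType) (A : finType) :
  [/\ proper_functor (smod_cubic nat A)
        /\ free_spans (@smod_trace nat A),
      proper_functor (smod_cubic (nonneg rat) A)
        /\ free_spans (@smod_trace (nonneg rat) A),
      proper_functor (smod_cubic (nonneg R) A)
        /\ free_spans (@smod_trace (nonneg R) A)
    & proper_functor (pca_cubic R A)
        /\ free_spans (@pca_trace R A)].
Proof.
split.
- by apply: smod_cubic_proper; [exact: nat_subtractive_fin_gen | exact: addnI].
- apply: smod_cubic_proper; last exact: nonneg_addrI.
  exact: nonneg_subtractive_fin_gen.
- apply: smod_cubic_proper; last exact: nonneg_addrI.
  exact: nonneg_subtractive_fin_gen.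
have spans := @pca_cubic_free_spans R A.
by split=> //; apply: free_spans_proper spans => X Y x y /pca_behav_eqP.
Qed.
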